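(* Reduction in $\lambda_{\mathbf{IEL}^{-}}$ is strongly normalising: if $\Gamma \vdash M : \varphi$ is derivable in $\lambda_{\mathbf{IEL}^{-}}$, then there is no infinite reduction sequence $M \to_r M_1 \to_r M_2 \to_r \cdots$.
   Context: The modal lambda calculus $\lambda_{\mathbf{IEL}^{-}}$. Types are generated from atomic types $p_0,p_1,\dots$ by $\varphi\to\psi$, $\varphi\times\psi$, $\bigcirc\varphi$. Terms are generated by: variables; $\lambda x.M$; $MN$; $\langle M,N\rangle$; $\pi_1 M$; $\pi_2 M$; $\mathbf{pure}\ M$; $\mathbf{let}\ \bigcirc\vec{x} = \vec{M}\ \mathbf{in}\ N$, where $\vec{x}$ is a finite (possibly empty) sequence of distinct variables and $\vec{M}$ a sequence of terms of the same length. Terms are considered up to renaming of bound variables; in $\mathbf{let}\ \bigcirc\vec{x} = \vec{M}\ \mathbf{in}\ N$ the variables $\vec x$ are bound in $N$. A context $\Gamma$ is a finite sequence of declarations $x_i:\varphi_i$ of distinct variables. Typing rules: (ax) $\Gamma, x:\varphi \vdash x:\varphi$; ($\to_i$) from $\Gamma,x:\varphi\vdash M:\psi$ infer $\Gamma\vdash\lambda x.M:\varphi\to\psi$; ($\to_e$) from $\Gamma\vdash M:\varphi\to\psi$ and $\Gamma\vdash N:\varphi$ infer $\Gamma\vdash MN:\psi$; ($\times_i$) from $\Gamma\vdash M:\varphi$ and $\Gamma\vdash N:\psi$ infer $\Gamma\vdash\langle M,N\rangle:\varphi\times\psi$; ($\times_e$) from $\Gamma\vdash M:\varphi_1\times\varphi_2$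 infer $\Gamma\vdash\pi_iM:\varphi_i$, $i=1,2$; ($\bigcirc_I$) from $\Gamma\vdash M:\varphi$ infer $\Gamma\vdash\mathbf{pure}\ M:\bigcirc\varphi$; ($\mathrm{let}_\bigcirc$) from $\Gamma\vdash M_1:\bigcirc\varphi_1,\dots,\Gamma\vdash M_n:\bigcirc\varphi_n$ and $x_1:\varphi_1,\dots,x_n:\varphi_n\vdash N:\psi$ infer $\Gamma\vdash\mathbf{let}\ \bigcirc x_1,\dots,x_n = M_1,\dots,M_n\ \mathbf{in}\ N:\bigcirc\psi$ ($n\ge 0$). Free variables are as usual, with $FV(\mathbf{let}\ \bigcirc\vec{x} = \vec{M}\ \mathbf{in}\ N)=\bigcup_i FV(M_i)$; substitution is the usual capture-avoiding one, with $(\mathbf{let}\ \bigcirc\vec{x} = \vec{M}\ \mathbf{in}\ N)[y:=P] = \mathbf{let}\ \bigcirc\vec{x} = (\vec{M}[y:=P])\ \mathbf{in}\ N$. One-step reduction $\to_r$ is the compatible closure (reduction may take place in any subterm) of: 1. $(\lambda x.M)N \to M[x:=N]$; 2. $\pi_1\langle M,N\rangle\to M$; 3. $\pi_2\langle M,N\rangle\to N$; 4. $\mathbf{let}\ \bigcirc\vec{x},y,\vec{z} = \vec{M},(\mathbf{let}\ \bigcirc\vec{w}=\vec{N}\ \mathbf{in}\ Q),\vec{P}\ \mathbf{in}\ R \;\to\; \mathbf{let}\ \bigcirc\vec{x},\vec{w},\vec{z} = \vec{M},\vec{N},\vec{P}\ \mathbf{in}\ R[y:=Q]$; 5. $\mathbf{let}\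 \bigcirc\vec{x}=\mathbf{pure}\ \vec{M}\ \mathbf{in}\ N \;\to\; \mathbf{pure}\ N[\vec{x}:=\vec{M}]$ (where $\mathbf{pure}\ \vec M$ is the sequence $\mathbf{pure}\ M_1,\dots,\mathbf{pure}\ M_n$); 6. $\mathbf{let}\ \bigcirc\underline{\ }=\underline{\ }\ \mathbf{in}\ M\;\to\;\mathbf{pure}\ M$, where $\underline{\ }$ is the empty sequence. *)

(* Defs.v *)
From Stdlib Require Import List Arith.
Import ListNotations.

(** The modal lambda calculus lambda_{IEL^-}, over Stdlib lists. *)

Inductive ty : Type :=
| Atom (p : nat)
| Arr (phi psi : ty)
| Prod (phi psi : ty)
| Circ (phi : ty).

(** Terms up to renaming of bound variables, in de Bruijn notation.
    [Lam] binds index 0 of its body.  [Let Ms N] is [let O xs = Ms in N]: it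
    binds in [N] the indices [0, ..., length Ms - 1], where index [i] is the
    variable paired with the [i]-th term of [Ms] (counting from 0, left to
    right).  The body [N] lives in a scope of its own and does not see the
    surrounding variables; in typable terms all its free indices are
    smaller than [length Ms]. *)
Inductive tm : Type :=
| Var (x : nat)
| Lam (M : tm)
| App (M N : tm)
| Pair (M N : tm)
| Proj1 (M : tm)
| Proj2 (M : tm)
| Pure (M : tm)
| Let (Ms : list tm) (N : tm).

(** A context lists the types of the variables 0, 1, 2, ... in this order, so
    that [phi :: Gamma] is the context written [Gamma, x : phi] on paper. *)
Definition ctx : Type := list ty.

Inductive typing : ctx -> tm -> ty -> Prop :=
| T_Var Gamma x phi :
    nth_error Gamma x = Some phi ->
    typing Gamma (Var x) phi
| T_Lam Gamma M phi psi :
    typing (phi :: Gamma) M psi ->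
    typing Gamma (Lam M) (Arr phi psi)
| T_App Gamma M N phi psi :
    typing Gamma M (Arr phi psi) ->
    typing Gamma N phi ->
    typing Gamma (App M N) psi
| T_Pair Gamma M N phi psi :
    typing Gamma M phi ->
    typing Gamma N psi ->
    typing Gamma (Pair M N) (Prod phi psi)
| T_Proj1 Gamma M phi1 phi2 :
    typing Gamma M (Prod phi1 phi2) ->
    typing Gamma (Proj1 M) phi1
| T_Proj2 Gamma M phi1 phi2 :
    typing Gamma M (Prod phi1 phi2) ->
    typing Gamma (Proj2 M) phi2
| T_Pure Gamma M phi :
    typing Gamma M phi ->
    typing Gamma (Pure M) (Circ phi)
| T_Let Gamma Ms N phis psi :
    Forall2 (fun M phi => typing Gamma M (Circ phi)) Ms phis ->
    typing phis N psi ->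
    typing Gamma (Let Ms N) (Circ psi).

Definition up_ren (xi : nat -> nat) (x : nat) : nat :=
  match x with
  | 0 => 0
  | S y => S (xi y)
  end.

(** Renaming, like substitution below, leaves the body of a [Let] alone. *)
Fixpoint rename (xi : nat -> nat) (M : tm) : tm :=
  match M with
  | Var x => Var (xi x)
  | Lam M => Lam (rename (up_ren xi) M)
  | App M N => App (rename xi M) (rename xi N)
  | Pair M N => Pair (rename xi M) (rename xi N)
  | Proj1 M => Proj1 (rename xi M)
  | Proj2 M => Proj2 (rename xi M)
  | Pure M => Pure (rename xi M)
  | Let Ms N => Let (map (rename xi) Ms) N
  end.

Definition up (sigma : nat -> tm) (x : nat) : tm :=
  match x with
  | 0 => Var 0
  | S y => rename S (sigma y)
  end.

(** Simultaneous capture-avoiding substitution. *)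
Fixpoint subst (sigma : nat -> tm) (M : tm) : tm :=
  match M with
  | Var x => sigma x
  | Lam M => Lam (subst (up sigma) M)
  | App M N => App (subst sigma M) (subst sigma N)
  | Pair M N => Pair (subst sigma M) (subst sigma N)
  | Proj1 M => Proj1 (subst sigma M)
  | Proj2 M => Proj2 (subst sigma M)
  | Pure M => Pure (subst sigma M)
  | Let Ms N => Let (map (subst sigma) Ms) N
  end.

(** [inst [P0; ...; Pk-1]] replaces the indices [0, ..., k-1] by the [Pi] and
    lowers the remaining indices by [k]. *)
Definition inst (Ps : list tm) (x : nat) : tm :=
  nth x Ps (Var (x - length Ps)).

(** [flatten m k Q] is the substitution [y := Q] that accompanies the passage
    from the scope [xs, y, zs] to the scope [xs, ws, zs], where [m] and [k]
    are the lengths of [xs] and [ws], and [Q] is in the scope [ws]: the [xs]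
    keep their indices, [y] (index [m]) becomes [Q] with the [ws] moved past
    the [xs], and the [zs] make room for [k] variables in place of one. *)
Definition flatten (m k : nat) (Q : tm) (x : nat) : tm :=
  match x ?= m with
  | Lt => Var x
  | Eq => rename (Nat.add m) Q
  | Gt => Var (x - 1 + k)
  end.

Inductive contract : tm -> tm -> Prop :=
| C_Beta M N :
    contract (App (Lam M) N) (subst (inst [N]) M)
| C_Proj1 M N :
    contract (Proj1 (Pair M N)) M
| C_Proj2 M N :
    contract (Proj2 (Pair M N)) N
| C_LetLet Ms Ns Q Ps R :
    contract (Let (Ms ++ Let Ns Q :: Ps) R)
             (Let (Ms ++ Ns ++ Ps)
                  (subst (flatten (length Ms) (length Ns) Q) R))
| C_LetPure Ms N :
    contract (Let (map Pure Ms) N) (Pure (subst (inst Ms) N))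
| C_LetNil M :
    contract (Let [] M) (Pure M).

Inductive step : tm -> tm -> Prop :=
| S_Contract M M' : contract M M' -> step M M'
| S_Lam M M' : step M M' -> step (Lam M) (Lam M')
| S_AppL M M' N : step M M' -> step (App M N) (App M' N)
| S_AppR M N N' : step N N' -> step (App M N) (App M N')
| S_PairL M M' N : step M M' -> step (Pair M N) (Pair M' N)
| S_PairR M N N' : step N N' -> step (Pair M N) (Pair M N')
| S_Proj1 M M' : step M M' -> step (Proj1 M) (Proj1 M')
| S_Proj2 M M' : step M M' -> step (Proj2 M) (Proj2 M')
| S_Pure M M' : step M M' -> step (Pure M) (Pure M')
| S_LetArg Ms M M' Ps N :
    step M M' -> step (Let (Ms ++ M :: Ps) N) (Let (Ms ++ M' :: Ps) N)
| S_LetBody Ms N N' : step N N' -> step (Let Ms N) (Let Ms N').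

(* Main.v *)
Require Import Defs.
From Stdlib Require Import List Arith Lia Relations Wellfounded.
Import ListNotations.

(** Interpret [Circ phi] by the continuation type [(phi -> o) -> o] with a fixed
    answer type [o]: [pure M] becomes [fun k => k M], and [let O xs = Ms in N]
    becomes [fun k => Mn (fun xn => ... M1 (fun x1 => k N))].  Both rule 4
    and rule 5 then turn into sequences of beta-steps; in rule 4 the
    continuation that consumes [y] is passed under the binders of [ws].  An
    identity redex around [N] makes rule 6 proper as well.  So every step of a
    typable term is simulated by at least one step of the simply typed
    lambda-calculus with products, which is strongly normalising by Tait's
    reducibility method. *)

(** * Renaming and simultaneous substitution *)

Lemma tm_nested_ind (P : tm -> Prop) :
  (forall x, P (Var x)) ->
  (forall M, P M -> P (Lam M)) ->
  (forall M N, P M -> P N -> P (App M N)) ->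
  (forall M N, P M -> P N -> P (Pair M N)) ->
  (forall M, P M -> P (Proj1 M)) ->
  (forall M, P M -> P (Proj2 M)) ->
  (forall M, P M -> P (Pure M)) ->
  (forall Ms N, Forall P Ms -> P N -> P (Let Ms N)) ->
  forall M, P M.
Proof.
  intros HV HL HA HP H1 H2 HU HLet.
  fix IH 1. intros [x|M|M N|M N|M|M|M|Ms N];
    [apply HV|apply HL|apply HA|apply HP|apply H1|apply H2|apply HU|apply HLet];
    try apply IH.
  (* An inner recursion along [Ms] exposes its members as subterms, so that the recursive calls to
     [IH] are guarded. *)
  induction Ms as [|M Ms IHMs]; constructor; [apply IH|apply IHMs].
Qed.

Lemma rename_ext M : forall xi zeta,
  (forall x, xi x = zeta x) -> rename xi M = rename zeta M.
Proof.
  induction M as [x|M IH|M N IHM IHN|M N IHM IHN|M IH|M IH|M IH|Ms N IHMs _]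
    using tm_nested_ind; intros xi zeta H; simpl; f_equal; auto.
  - apply IH. intros [|x]; simpl; auto.
  - apply map_ext_Forall. revert IHMs. apply Forall_impl. auto.
Qed.

Lemma subst_ext M : forall sigma tau,
  (forall x, sigma x = tau x) -> subst sigma M = subst tau M.
Proof.
  induction M as [x|M IH|M N IHM IHN|M N IHM IHN|M IH|M IH|M IH|Ms N IHMs _]
    using tm_nested_ind; intros sigma tau H; simpl; f_equal; auto.
  - apply IH. intros [|x]; simpl; [|rewrite H]; auto.
  - apply map_ext_Forall. revert IHMs. apply Forall_impl. auto.
Qed.

Lemma rename_subst_Var M : forall xi,
  rename xi M = subst (fun x => Var (xi x)) M.
Proof.
  induction M as [x|M IH|M N IHM IHN|M N IHM IHN|M IH|M IH|M IH|Ms N IHMs _]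
    using tm_nested_ind; intros xi; simpl; f_equal; auto.
  - rewrite IH. apply subst_ext. intros [|x]; reflexivity.
  - apply map_ext_Forall. revert IHMs. apply Forall_impl. auto.
Qed.

Lemma subst_Var M : forall sigma,
  (forall x, sigma x = Var x) -> subst sigma M = M.
Proof.
  induction M as [x|M IH|M N IHM IHN|M N IHM IHN|M IH|M IH|M IH|Ms N IHMs _]
    using tm_nested_ind; intros sigma H; simpl; f_equal; auto.
  - apply IH. intros [|x]; simpl; [|rewrite H]; auto.
  - rewrite <- map_id. apply map_ext_Forall. revert IHMs. apply Forall_impl. auto.
Qed.

Lemma rename_id M xi : (forall x, xi x = x) -> rename xi M = M.
Proof.
  intros H. rewrite rename_subst_Var. apply subst_Var. intros x. now rewrite H.
Qed.

Lemma subst_rename M : forall sigma xi,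
  subst sigma (rename xi M) = subst (fun x => sigma (xi x)) M.
Proof.
  induction M as [x|M IH|M N IHM IHN|M N IHM IHN|M IH|M IH|M IH|Ms N IHMs _]
    using tm_nested_ind; intros sigma xi; simpl; f_equal; auto.
  - rewrite IH. apply subst_ext. intros [|x]; reflexivity.
  - rewrite map_map. apply map_ext_Forall. revert IHMs. apply Forall_impl. auto.
Qed.

Lemma rename_rename M xi zeta :
  rename xi (rename zeta M) = rename (fun x => xi (zeta x)) M.
Proof.
  rewrite (rename_subst_Var _ xi), subst_rename. symmetry. apply rename_subst_Var.
Qed.

Lemma rename_subst M : forall sigma xi,
  rename xi (subst sigma M) = subst (fun x => rename xi (sigma x)) M.
Proof.
  induction M as [x|M IH|M N IHM IHN|M N IHM IHN|M IH|M IH|M IH|Ms N IHMs _]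
    using tm_nested_ind; intros sigma xi; simpl; f_equal; auto.
  - rewrite IH. apply subst_ext. intros [|x]; simpl; auto.
    now rewrite !rename_rename.
  - rewrite map_map. apply map_ext_Forall. revert IHMs. apply Forall_impl. auto.
Qed.

Lemma subst_subst M : forall sigma tau,
  subst tau (subst sigma M) = subst (fun x => subst tau (sigma x)) M.
Proof.
  induction M as [x|M IH|M N IHM IHN|M N IHM IHN|M IH|M IH|M IH|Ms N IHMs _]
    using tm_nested_ind; intros sigma tau; simpl; f_equal; auto.
  - rewrite IH. apply subst_ext. intros [|x]; simpl; auto.
    now rewrite subst_rename, rename_subst.
  - rewrite map_map. apply map_ext_Forall. revert IHMs. apply Forall_impl. auto.
Qed.

Lemma iter_up k sigma x :
  Nat.iter k up sigma x =
  if x <? k then Var x else rename (Nat.add k) (sigma (x - k)).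
Proof.
  revert x. induction k as [|k IH]; intros x; simpl.
  - rewrite Nat.sub_0_r. symmetry. now apply rename_id.
  - destruct x as [|x]; simpl; auto.
    rewrite IH. change (S x <? S k) with (x <? k).
    destruct (x <? k); simpl; auto.
    rewrite rename_rename. now apply rename_ext.
Qed.

Lemma inst_singleton_S N x : inst [N] (S x) = Var x.
Proof. destruct x; reflexivity. Qed.

(** A beta step after a substitution amounts to extending that substitution by the argument; this is
    how the abstraction case of [typing_red] uses its induction hypothesis. *)
Lemma subst_inst_up sigma N M :
  subst (inst [N]) (subst (up sigma) M) =
  subst (fun x => match x with 0 => N | S y => sigma y end) M.
Proof.
  rewrite subst_subst. apply subst_ext. intros [|x]; simpl; auto.
  rewrite subst_rename. apply subst_Var. intros y. apply inst_singleton_S.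
Qed.

Lemma subst_inst sigma N M :
  subst sigma (subst (inst [N]) M) =
  subst (inst [subst sigma N]) (subst (up sigma) M).
Proof.
  rewrite subst_inst_up, subst_subst. apply subst_ext.
  intros [|x]; unfold inst; simpl; auto.
  destruct x; simpl; auto.
Qed.

Lemma subst_inst_rename_S N M : subst (inst [N]) (rename S M) = M.
Proof.
  rewrite subst_rename. apply subst_Var. intros [|x]; reflexivity.
Qed.

(** * Typing *)

Lemma typing_rename M : forall Gamma Delta xi phi,
  typing Gamma M phi ->
  (forall x psi, nth_error Gamma x = Some psi -> nth_error Delta (xi x) = Some psi) ->
  typing Delta (rename xi M) phi.
Proof.
  induction M as [x|M IH|M N IHM IHN|M N IHM IHN|M IH|M IH|M IH|Ms N IHMs _]
    using tm_nested_ind; intros Gamma Delta xi phi HM Hxi; inversion HM; subst;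
    simpl; try (econstructor; eauto; fail).
  - constructor. eapply IH; [eassumption|]. intros [|x]; simpl; auto.
  - econstructor; [|eassumption]. rewrite Forall_forall in IHMs.
    clear - IHMs Hxi H2. induction H2; simpl; constructor.
    + eapply IHMs; eauto. now left.
    + apply IHForall2. intros; eapply IHMs; eauto. now right.
Qed.

Definition typed_subst (Gamma Delta : ctx) (sigma : nat -> tm) : Prop :=
  forall x psi, nth_error Gamma x = Some psi -> typing Delta (sigma x) psi.

Lemma typed_subst_up Gamma Delta sigma phi :
  typed_subst Gamma Delta sigma ->
  typed_subst (phi :: Gamma) (phi :: Delta) (up sigma).
Proof.
  intros H [|x] psi Hx; simpl in *.
  - now constructor.
  - eapply typing_rename; [apply H; eassumption|]. auto.
Qed.

Lemma typing_subst M : forall Gamma Delta sigma phi,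
  typing Gamma M phi -> typed_subst Gamma Delta sigma ->
  typing Delta (subst sigma M) phi.
Proof.
  induction M as [x|M IH|M N IHM IHN|M N IHM IHN|M IH|M IH|M IH|Ms N IHMs _]
    using tm_nested_ind; intros Gamma Delta sigma phi HM Hs; inversion HM; subst;
    simpl; try (econstructor; eauto; fail).
  - now apply Hs.
  - constructor. eapply IH; eauto using typed_subst_up.
  - econstructor; [|eassumption]. rewrite Forall_forall in IHMs.
    clear - IHMs Hs H2. induction H2; simpl; constructor.
    + eapply IHMs; eauto. now left.
    + apply IHForall2. intros; eapply IHMs; eauto. now right.
Qed.

(** Translated substitutions are controlled only at declared indices, where the substituted terms
    are typed; a typed term looks at no others. *)
Lemma subst_ext_typed M : forall Gamma phi sigma tau,
  typing Gamma M phi ->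
  (forall x, x < length Gamma -> sigma x = tau x) ->
  subst sigma M = subst tau M.
Proof.
  induction M as [x|M IH|M N IHM IHN|M N IHM IHN|M IH|M IH|M IH|Ms N IHMs _]
    using tm_nested_ind; intros Gamma phi sigma tau HM H; inversion HM; subst;
    simpl; [apply H, nth_error_Some; congruence|f_equal; eauto ..].
  - eapply IH; [eassumption|]. intros [|x] Hx; simpl in *; auto.
    rewrite H; auto. lia.
  - rewrite Forall_forall in IHMs.
    clear - IHMs H H3. induction H3; simpl; auto. f_equal.
    + eapply IHMs; eauto. now left.
    + apply IHForall2. intros; eapply IHMs; eauto. now right.
Qed.

(** New variables at the far end of the context shift no index, so the term itself stays the
    same. *)
Lemma typing_app_r Gamma Delta M phi :
  typing Gamma M phi -> typing (Gamma ++ Delta) M phi.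
Proof.
  intros HM. rewrite <- (rename_id M (fun x => x)) by auto.
  eapply typing_rename; [eassumption|]. intros x psi Hx.
  rewrite nth_error_app1; auto. apply nth_error_Some. congruence.
Qed.

Lemma typing_rename_add Gamma Delta M phi :
  typing Delta M phi -> typing (Gamma ++ Delta) (rename (Nat.add (length Gamma)) M) phi.
Proof.
  intros HM. eapply typing_rename; [eassumption|]. intros x psi Hx.
  rewrite nth_error_app2 by lia. rewrite <- Hx. f_equal. lia.
Qed.

Lemma typed_subst_inst Gamma Ms phis :
  Forall2 (typing Gamma) Ms phis -> typed_subst (phis ++ Gamma) Gamma (inst Ms).
Proof.
  induction 1 as [|M phi Ms phis HM HMs IH]; intros x psi Hx; simpl in Hx.
  - unfold inst. simpl. destruct x; simpl; now constructor.
  - destruct x as [|x]; unfold inst in *; simpl in *.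
    + congruence.
    + now apply IH.
Qed.

Lemma typed_subst_flatten phis chis psi psis Q :
  typing chis Q psi ->
  typed_subst (phis ++ psi :: psis) (phis ++ chis ++ psis)
    (flatten (length phis) (length chis) Q).
Proof.
  intros HQ x theta Hx. unfold flatten.
  destruct (Nat.compare_spec x (length phis)) as [->|Hlt|Hgt].
  - rewrite nth_error_app2, Nat.sub_diag in Hx by lia. simpl in Hx.
    injection Hx as <-. apply typing_rename_add. now apply typing_app_r.
  - constructor. rewrite nth_error_app1 in * by lia. assumption.
  - constructor. rewrite nth_error_app2 in Hx by lia.
    destruct (x - length phis) as [|y] eqn:E; [lia|]. simpl in Hx.
    rewrite nth_error_app2, nth_error_app2 by lia. rewrite <- Hx. f_equal. lia.
Qed.

Lemma typing_map_Pure Gamma Ms phis :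
  Forall2 (fun M phi => typing Gamma M (Circ phi)) (map Pure Ms) phis ->
  Forall2 (typing Gamma) Ms phis.
Proof.
  revert phis. induction Ms as [|M Ms IH]; intros phis HMs; inversion HMs; subst;
    constructor; auto.
  match goal with H : typing _ (Pure _) _ |- _ => now inversion H end.
Qed.

(** * Subject reduction *)

Lemma subject_reduction_contract Gamma M M' phi :
  contract M M' -> typing Gamma M phi -> typing Gamma M' phi.
Proof.
  intros H HM. destruct H as [M N|M N|M N|Ms Ns Q Ps R|Ms N|M].
  - inversion HM as [| |? ? ? chi ? HL HN| | | | |]; subst.
    inversion HL; subst. eapply typing_subst; [eassumption|].
    apply (typed_subst_inst Gamma [N] [chi]). auto.
  - inversion HM as [| | | |? ? ? ? HP| | |]; subst. now inversion HP.
  - inversion HM as [| | | | |? ? ? ? HP| |]; subst. now inversion HP.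
  - inversion HM as [| | | | | | |? ? ? phis psi HMs HR]; subst.
    apply Forall2_app_inv_l in HMs as (phis1 & phis2 & H1 & H2 & ->).
    inversion H2 as [|? chi ? psis HL HP]; subst.
    inversion HL as [| | | | | | |? ? ? chis ? HN HQ]; subst.
    apply T_Let with (phis1 ++ chis ++ psis).
    + now apply Forall2_app, Forall2_app.
    + rewrite (Forall2_length H1), (Forall2_length HN).
      eapply typing_subst; [eassumption|]. now apply typed_subst_flatten.
  - inversion HM as [| | | | | | |? ? ? phis psi HMs HN]; subst.
    (* The body is typed in the scope [phis] alone; weakening by [Gamma] makes room for the
       variables of the substituted terms. *)
    constructor. eapply typing_subst; [apply typing_app_r; eassumption|].
    now apply typed_subst_inst, typing_map_Pure.
  - inversion HM as [| | | | | | |? ? ? phis psi HMs HN]; subst.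
    inversion HMs; subst. constructor. now apply (typing_app_r []).
Qed.

Lemma subject_reduction M M' :
  step M M' -> forall Gamma phi, typing Gamma M phi -> typing Gamma M' phi.
Proof.
  induction 1; intros Gamma phi HM;
    try (inversion HM; subst; econstructor; eauto; fail).
  - eauto using subject_reduction_contract.
  - inversion HM as [| | | | | | |? ? ? phis psi HMs HR]; subst.
    apply T_Let with phis; auto.
    apply Forall2_app_inv_l in HMs as (phis1 & phis2 & H1 & H2 & ->).
    inversion H2; subst. apply Forall2_app; auto.
Qed.

(** * Strong normalisation of the simply typed fragment *)

(* [Pure] and [Let] are inert, so [Circ phi] behaves as an atomic type. *)
Inductive bstep : tm -> tm -> Prop :=
| B_Beta M N : bstep (App (Lam M) N) (subst (inst [N]) M)
| B_Pair1 M N : bstep (Proj1 (Pair M N)) M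
| B_Pair2 M N : bstep (Proj2 (Pair M N)) N
| B_Lam M M' : bstep M M' -> bstep (Lam M) (Lam M')
| B_AppL M M' N : bstep M M' -> bstep (App M N) (App M' N)
| B_AppR M N N' : bstep N N' -> bstep (App M N) (App M N')
| B_PairL M M' N : bstep M M' -> bstep (Pair M N) (Pair M' N)
| B_PairR M N N' : bstep N N' -> bstep (Pair M N) (Pair M N')
| B_Proj1 M M' : bstep M M' -> bstep (Proj1 M) (Proj1 M')
| B_Proj2 M M' : bstep M M' -> bstep (Proj2 M) (Proj2 M').

Lemma bstep_subst M M' :
  bstep M M' -> forall sigma, bstep (subst sigma M) (subst sigma M').
Proof.
  induction 1; intros sigma; simpl; try (constructor; auto; fail).
  rewrite subst_inst. constructor.
Qed.

Lemma bstep_rename M M' xi :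
  bstep M M' -> bstep (rename xi M) (rename xi M').
Proof. rewrite !rename_subst_Var. intros H. now apply bstep_subst. Qed.

Definition SN : tm -> Prop := Acc (fun M' M => bstep M M').

(** An infinite reduction from [M] would be carried by [f] to one from [f M]. *)
Lemma SN_pullback (f : tm -> tm) :
  (forall M M', bstep M M' -> bstep (f M) (f M')) ->
  forall M, SN (f M) -> SN M.
Proof.
  intros Hf M H. remember (f M) as T eqn:E. revert M E.
  induction H as [T _ IH]; intros M ->. constructor. intros M' HM.
  eapply IH; [apply Hf; eassumption|reflexivity].
Qed.

Fixpoint red (phi : ty) (M : tm) : Prop :=
  match phi with
  | Atom _ | Circ _ => SN M
  | Arr phi psi => forall N, red phi N -> red psi (App M N)
  | Prod phi psi => red phi (Proj1 M) /\ red psi (Proj2 M)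
  end.

(** A neutral term in head position creates no new redex; [Pure] and [Let] qualify because no rule
    of [bstep] eliminates them. *)
Definition neutral (M : tm) : Prop :=
  match M with Lam _ | Pair _ _ => False | _ => True end.

Lemma red_bstep phi : forall M M', red phi M -> bstep M M' -> red phi M'.
Proof.
  induction phi as [p|phi IHphi psi IHpsi|phi IHphi psi IHpsi|phi _];
    simpl; intros M M' HM Hst.
  - now apply (Acc_inv HM).
  - intros N HN. eapply IHpsi; [apply HM; eassumption|now constructor].
  - destruct HM as [H1 H2].
    split; [eapply IHphi|eapply IHpsi]; try eassumption; now constructor.
  - now apply (Acc_inv HM).
Qed.

(** The two properties need a joint induction: at an arrow, the first obtains a reducible variable
    from the second at the domain, and the second inducts on the normalisation of an argument given
    by the first at the domain. *)
Lemma red_SN_neutral phi :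
  (forall M, red phi M -> SN M) /\
  (forall M, neutral M -> (forall M', bstep M M' -> red phi M') -> red phi M).
Proof.
  induction phi as [p|phi [CR1phi CR3phi] psi [CR1psi CR3psi]
                     |phi [CR1phi CR3phi] psi [CR1psi CR3psi]|phi _];
    simpl; (split; intros M HM; [|intros Hst]).
  - assumption.
  - now constructor.
  - apply (SN_pullback (fun M => App M (Var 0))); [now constructor|].
    apply CR1psi, HM, CR3phi; [exact I|]. intros M' H. inversion H.
  - intros N HN. pose proof (CR1phi _ HN) as SNN. revert HN.
    induction SNN as [N _ IH]; intros HN. apply CR3psi; [exact I|].
    (* Neutrality excludes a beta step at the root; the remaining steps take place in the function
       or in the argument. *)
    intros M' H. inversion H; subst; [contradiction|now apply Hst|].
    apply IH; eauto using red_bstep.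
  - destruct HM as [H _].
    apply (SN_pullback Proj1); [now constructor|now apply CR1phi].
  - split; [apply CR3phi|apply CR3psi]; try exact I; intros M' H;
      inversion H; subst; try contradiction; now apply Hst.
  - assumption.
  - now constructor.
Qed.

Lemma red_SN phi M : red phi M -> SN M.
Proof. apply red_SN_neutral. Qed.

Lemma red_neutral phi M :
  neutral M -> (forall M', bstep M M' -> red phi M') -> red phi M.
Proof. apply red_SN_neutral. Qed.

Lemma red_Var phi x : red phi (Var x).
Proof. apply red_neutral; [exact I|]. intros M' H. inversion H. Qed.

(** The term [App (Lam M) N] is neutral, so its reducts suffice. A double induction on the
    normalisation of [M] and [N] handles inner steps, and the root step is the hypothesis. *)
Lemma red_Lam phi psi M :
  (forall N, red phi N -> red psi (subst (inst [N]) M)) -> red (Arr phi psi) (Lam M).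
Proof.
  intros HM N HN.
  assert (SNM : SN M).
  (* The instance of [M] at a variable is reducible, hence normalising, and substitution preserves
     steps. *)
  { apply (SN_pullback (subst (inst [Var 0]))); [auto using bstep_subst|].
    apply (red_SN psi), HM, red_Var. }
  pose proof (red_SN _ _ HN) as SNN. revert N SNN HN HM.
  induction SNM as [M HSM IHM]. intros N SNN.
  induction SNN as [N HSN IHN]. intros HN HM.
  apply red_neutral; [exact I|].
  intros M' H. inversion H; subst; auto.
  - match goal with H : bstep (Lam _) _ |- _ => inversion H; subst end.
    apply IHM; auto; [now constructor|].
    intros P HP. eapply red_bstep; [apply HM; eassumption|now apply bstep_subst].
  - apply IHN; eauto using red_bstep.
Qed.

Lemma red_Pair phi psi M N :
  red phi M -> red psi N -> red (Prod phi psi) (Pair M N).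
Proof.
  intros HM HN.
  pose proof (red_SN _ _ HM) as SNM. pose proof (red_SN _ _ HN) as SNN.
  revert N SNN HM HN. induction SNM as [M HSM IHM]. intros N SNN.
  induction SNN as [N HSN IHN]. intros HM HN.
  split; (apply red_neutral; [exact I|]); intros M' H; inversion H; subst; auto;
    match goal with H : bstep (Pair _ _) _ |- _ => inversion H; subst end;
    ((apply IHM; eauto using red_bstep; now constructor)
     || (apply IHN; eauto using red_bstep)).
Qed.

(** The fundamental lemma of reducibility. Terms headed by [Pure] or [Let] have no [bstep] at all,
    so they are trivially reducible at a type [Circ phi]. *)
Lemma typing_red M : forall Gamma phi sigma,
  typing Gamma M phi ->
  (forall x psi, nth_error Gamma x = Some psi -> red psi (sigma x)) ->
  red phi (subst sigma M).
Proof.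
  induction M as [x|M IH|M N IHM IHN|M N IHM IHN|M IH|M IH|M _|Ms N _ _]
    using tm_nested_ind; intros Gamma phi sigma HM Hs; inversion HM; subst; simpl.
  - now apply Hs.
  - apply red_Lam. intros N HN. rewrite subst_inst_up.
    eapply IH; [eassumption|]. intros [|x] theta Hx; simpl in *; [|now apply Hs].
    congruence.
  - apply (IHM _ _ _ ltac:(eassumption) Hs). eapply IHN; eassumption.
  - apply red_Pair; eauto.
  - apply (IH _ _ _ ltac:(eassumption) Hs).
  - apply (IH _ _ _ ltac:(eassumption) Hs).
  - constructor. intros M' H. inversion H.
  - constructor. intros M' H. inversion H.
Qed.

Lemma typing_SN Gamma M phi : typing Gamma M phi -> SN M.
Proof.
  intros HM. apply (red_SN phi). rewrite <- (subst_Var M Var) by auto.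
  eapply typing_red; [eassumption|]. intros x psi _. apply red_Var.
Qed.

(** * Continuation-passing translation *)

(* [chain [M0; ...; Mn-1] B] is
   [Mn-1 (fun xn-1 => ... M0 (fun x0 => B))]; this order of binding gives
   [xi] the index [i] in [B], as in the body of a [Let]. *)
Fixpoint chain (Ms : list tm) (B : tm) : tm :=
  match Ms with
  | [] => B
  | M :: Ms => chain Ms (App (rename (Nat.add (length Ms)) M) (Lam B))
  end.

(* The redex [App (Lam (Var 0)) _] makes the translation of [C_LetNil], and of
   [C_LetPure] with no arguments, a proper reduction. *)
Fixpoint trans (M : tm) : tm :=
  match M with
  | Var x => Var x
  | Lam M => Lam (trans M)
  | App M N => App (trans M) (trans N)
  | Pair M N => Pair (trans M) (trans N)
  | Proj1 M => Proj1 (trans M)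
  | Proj2 M => Proj2 (trans M)
  | Pure M => Lam (App (Var 0) (rename S (trans M)))
  | Let Ms N =>
      Lam (chain (map (rename S) (map trans Ms))
             (App (Var (length Ms)) (App (Lam (Var 0)) (trans N))))
  end.

(** [Atom 0] also serves as the answer type [o]. *)
Fixpoint trans_ty (phi : ty) : ty :=
  match phi with
  | Atom p => Atom p
  | Arr phi psi => Arr (trans_ty phi) (trans_ty psi)
  | Prod phi psi => Prod (trans_ty phi) (trans_ty psi)
  | Circ phi => Arr (Arr (trans_ty phi) (Atom 0)) (Atom 0)
  end.

(** Later terms bind further out, so those of [Ms] end up under the [length Ps] binders of [Ps]. *)
Lemma chain_app Ms Ps B :
  chain (Ms ++ Ps) B = chain Ps (chain (map (rename (Nat.add (length Ps))) Ms) B).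
Proof.
  revert B. induction Ms as [|M Ms IH]; intros B; simpl; auto.
  rewrite IH, length_app, length_map, rename_rename. do 3 f_equal.
  apply rename_ext. intros x. lia.
Qed.

Lemma subst_chain Ms : forall sigma B,
  subst sigma (chain Ms B) =
  chain (map (subst sigma) Ms) (subst (Nat.iter (length Ms) up sigma) B).
Proof.
  induction Ms as [|M Ms IH]; intros sigma B; simpl; auto.
  rewrite IH, length_map. simpl. do 2 f_equal.
  rewrite subst_rename, rename_subst. apply subst_ext. intros x.
  rewrite iter_up. destruct (Nat.ltb_spec (length Ms + x) (length Ms)); [lia|].
  f_equal. f_equal. lia.
Qed.

Lemma bstep_chain_body Ms : forall B B',
  bstep B B' -> bstep (chain Ms B) (chain Ms B').
Proof.
  induction Ms as [|M Ms IH]; intros B B' H; simpl; auto.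
  now apply IH, B_AppR, B_Lam.
Qed.

Lemma bstep_chain_arg Ms M M' Ps B :
  bstep M M' -> bstep (chain (Ms ++ M :: Ps) B) (chain (Ms ++ M' :: Ps) B).
Proof.
  intros H. rewrite !chain_app. simpl.
  now apply bstep_chain_body, B_AppL, bstep_rename.
Qed.

Lemma typing_chain Gamma Ms phis : forall B psi,
  Forall2 (fun M phi => typing Gamma M (Arr (Arr phi psi) psi)) Ms phis ->
  typing (phis ++ Gamma) B psi ->
  typing Gamma (chain Ms B) psi.
Proof.
  intros B psi H. revert B.
  induction H as [|M phi Ms phis HM HMs IH]; intros B HB; simpl; auto.
  apply IH. econstructor; [|constructor; exact HB].
  rewrite (Forall2_length HMs). now apply typing_rename_add.
Qed.

Lemma typing_trans M : forall Gamma phi,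
  typing Gamma M phi -> typing (map trans_ty Gamma) (trans M) (trans_ty phi).
Proof.
  induction M as [x|M IH|M N IHM IHN|M N IHM IHN|M IH|M IH|M IH|Ms N IHMs IHN]
    using tm_nested_ind; intros Gamma phi HM; inversion HM; subst; simpl.
  - constructor. now apply map_nth_error.
  - constructor. now apply (IH (_ :: _)).
  - eapply T_App; [eapply (IHM _ (Arr _ _)); eassumption|auto].
  - constructor; auto.
  - eapply T_Proj1, (IH _ (Prod _ _)). eassumption.
  - eapply T_Proj2, (IH _ (Prod _ _)). eassumption.
  - do 2 econstructor; [now constructor|].
    eapply typing_rename; [eauto|]. auto.
  - constructor. apply typing_chain with (map trans_ty phis).
    + rewrite Forall_forall in IHMs. clear - IHMs H2.
      induction H2; simpl; constructor.
      * eapply typing_rename; [apply (IHMs x (or_introl eq_refl) Gamma (Circ y) H)|].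
        auto.
      * apply IHForall2. intros; apply IHMs; auto. now right.
    + econstructor; [constructor|].
      (* The continuation is bound outside the whole chain, hence its index is [length Ms]. *)
      * rewrite nth_error_app2; rewrite length_map, (Forall2_length H2); auto.
        now rewrite Nat.sub_diag.
      * econstructor; [constructor; now constructor|].
        apply typing_app_r. auto.
Qed.

Lemma subst_closed Gamma M phi sigma :
  typing Gamma M phi -> (forall x, x < length Gamma -> sigma x = Var x) ->
  subst sigma M = M.
Proof.
  intros HM H. rewrite (subst_ext_typed _ _ _ sigma Var HM H). now apply subst_Var.
Qed.

Lemma subst_iter_up_closed Gamma M phi sigma k :
  typing Gamma M phi -> length Gamma = k -> subst (Nat.iter k up sigma) M = M.
Proof.
  intros HM <-. eapply subst_closed; [eassumption|]. intros x Hx.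
  rewrite iter_up. now apply Nat.ltb_lt in Hx as ->.
Qed.

(** The body of a [Let] is skipped by [subst], but its translation sits in the ambient scope. Typing
    bounds its indices by [length Ms], so the substitution lifted under the chain fixes it. *)
Lemma subst_trans_Let phis Ms N psi sigma :
  typing phis N psi -> length phis = length Ms ->
  subst sigma (trans (Let Ms N)) =
  Lam (chain (map (rename S) (map (subst sigma) (map trans Ms)))
         (App (Var (length Ms)) (App (Lam (Var 0)) (trans N)))).
Proof.
  intros HN Hlen. simpl. rewrite subst_chain, !length_map. do 2 f_equal.
  - rewrite !map_map. apply map_ext. intros M.
    rewrite subst_rename, rename_subst. reflexivity.
  - simpl. f_equal; [|do 2 f_equal].
    + rewrite iter_up, Nat.ltb_irrefl, Nat.sub_diag. simpl. f_equal. lia.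
    + eapply subst_iter_up_closed; [eapply typing_trans; eassumption|]. now rewrite length_map.
Qed.

Lemma trans_rename M : forall Gamma phi xi,
  typing Gamma M phi -> trans (rename xi M) = rename xi (trans M).
Proof.
  induction M as [x|M IH|M N IHM IHN|M N IHM IHN|M IH|M IH|M IH|Ms N IHMs _]
    using tm_nested_ind; intros Gamma phi xi HM; inversion HM; subst;
    try (simpl; f_equal; eauto; fail).
  - simpl. erewrite IH by eassumption. now rewrite !rename_rename.
  - rewrite (rename_subst_Var (trans _)).
    erewrite subst_trans_Let by eauto using Forall2_length, eq_sym.
    simpl. rewrite length_map. do 3 f_equal. rewrite Forall_forall in IHMs.
    clear - IHMs H2. induction H2; simpl; auto. f_equal.
    + rewrite <- rename_subst_Var. eapply IHMs; eauto. now left.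
    + apply IHForall2. intros; eapply IHMs; eauto. now right.
Qed.

Lemma trans_subst M : forall Gamma Delta phi sigma,
  typing Gamma M phi -> typed_subst Gamma Delta sigma ->
  trans (subst sigma M) = subst (fun x => trans (sigma x)) (trans M).
Proof.
  induction M as [x|M IH|M N IHM IHN|M N IHM IHN|M IH|M IH|M IH|Ms N IHMs _]
    using tm_nested_ind; intros Gamma Delta phi sigma HM Hs; inversion HM; subst;
    try (simpl; f_equal; eauto; fail).
  - simpl. f_equal. erewrite IH by eauto using typed_subst_up.
    eapply subst_ext_typed; [apply typing_trans; eassumption|].
    (* Commuting [trans] with the shift in [up] requires [sigma x] to be typed, which is known only
       for declared [x]. *)
    intros [|x] Hx; simpl in *; auto. rewrite length_map in Hx.
    destruct (nth_error Gamma x) as [theta|] eqn:E.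
    + apply trans_rename with Delta theta. now apply Hs.
    + apply nth_error_None in E. lia.
  - simpl. erewrite IH by eassumption. do 2 f_equal.
    rewrite subst_rename, rename_subst. reflexivity.
  - erewrite subst_trans_Let by eauto using Forall2_length, eq_sym.
    simpl. rewrite length_map. do 3 f_equal. rewrite Forall_forall in IHMs.
    clear - IHMs Hs H2. induction H2; simpl; auto. f_equal.
    + eapply IHMs; eauto. now left.
    + apply IHForall2. intros; eapply IHMs; eauto. now right.
Qed.

(** * Simulation *)

Notation bsteps := (clos_refl_trans tm bstep).
Notation bplus := (clos_trans tm bstep).

Lemma bplus_congr (f : tm -> tm) :
  (forall M M', bstep M M' -> bstep (f M) (f M')) ->
  forall M M', bplus M M' -> bplus (f M) (f M').
Proof. intros Hf M M'. induction 1; [constructor; auto|eapply t_trans; eassumption]. Qed.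

(** The terms are consumed from the innermost one outwards, with two beta steps each: the term
    receives its continuation, then the continuation receives the value. *)
Lemma chain_pure Ms : forall B,
  bsteps (chain (map (fun M => Lam (App (Var 0) (rename S M))) Ms) B)
    (subst (inst Ms) B).
Proof.
  induction Ms as [|M Ms IH]; intros B; simpl.
  - rewrite subst_Var; [apply rt_refl|]. intros [|x]; reflexivity.
  - rewrite length_map.
    apply rt_trans with (chain (map (fun M => Lam (App (Var 0) (rename S M))) Ms)
      (subst (inst [rename (Nat.add (length Ms)) M]) B)).
    + eapply rt_trans; apply rt_step, bstep_chain_body; [apply B_Beta|].
      simpl. change (inst [Lam B] 0) with (Lam B).
      replace (subst _ _) with (rename (Nat.add (length Ms)) M); [apply B_Beta|].
      rewrite <- (subst_inst_rename_S (Lam B) (rename _ M)). f_equal.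
      rewrite !rename_rename. reflexivity.
    (* Simultaneous substitution splits: first [M], shifted past the remaining variables, then [Ms],
       which undoes the shift. *)
    + replace (subst (inst (M :: Ms)) B)
        with (subst (inst Ms) (subst (inst [rename (Nat.add (length Ms)) M]) B));
        [apply IH|].
      rewrite subst_subst. apply subst_ext. intros [|x]; unfold inst; simpl.
      * rewrite subst_rename. apply subst_Var. intros x.
        rewrite nth_overflow by lia. f_equal. lia.
      * destruct x; reflexivity.
Qed.

Lemma simulate_LetPure Gamma Ms N phi :
  typing Gamma (Let (map Pure Ms) N) phi ->
  bplus (trans (Let (map Pure Ms) N)) (trans (Pure (subst (inst Ms) N))).
Proof.
  intros HM. inversion HM as [| | | | | | |? ? ? phis psi HMs HN]; subst.
  simpl. apply bplus_congr; [now constructor|].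
  assert (Hlen : length phis = length Ms).
  { rewrite <- (Forall2_length HMs). apply length_map. }
  pose proof (typing_map_Pure _ _ _ HMs) as HMs'.
  (* The chain contracts in possibly zero steps; firing the identity redex last provides the strict
     one. *)
  eapply clos_rt_t; [|apply t_step, B_AppR, (B_Beta (Var 0))].
  replace (App (Var 0) _) with
    (subst (inst (map (rename S) (map trans Ms)))
      (App (Var (length (map Pure Ms))) (App (Lam (Var 0)) (trans N)))).
  - replace (map (rename S) (map trans (map Pure Ms))) with
      (map (fun M => Lam (App (Var 0) (rename S M))) (map (rename S) (map trans Ms)));
      [apply chain_pure|].
    rewrite !map_map. apply map_ext. intros M. simpl. rewrite !rename_rename.
    do 2 f_equal.
  (* The index of the continuation is just out of the range of [inst], whose default lowers it to
     [Var 0]. *)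
  - simpl. rewrite length_map. unfold inst at 1.
    rewrite nth_overflow; rewrite !length_map; [|lia]. rewrite Nat.sub_diag.
    do 2 f_equal.
    rewrite (trans_subst N (phis ++ Gamma) Gamma psi)
      by auto using typing_app_r, typed_subst_inst.
    rewrite rename_subst.
    eapply subst_ext_typed; [apply typing_trans; eassumption|].
    intros x Hx. rewrite length_map in Hx. unfold inst.
    (* Since [x] is in range, the default of [nth] may be replaced by one of the shape that
       [map_nth] expects. *)
    rewrite map_map, nth_indep with (d' := rename S (trans (Var 0)))
      by (rewrite length_map; lia).
    rewrite (map_nth (fun M => rename S (trans M))).
    f_equal. f_equal. apply nth_indep. lia.
Qed.

(** With [Ps] peeled off, three beta steps remain: the identity redex around [Q], passing the
    continuation to the inner [Let], and applying that continuation to [Q] under the binders of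
    [Ns]. The rest matches indices with [flatten]. *)
Lemma simulate_LetLet Gamma Ms Ns Q Ps R phi :
  typing Gamma (Let (Ms ++ Let Ns Q :: Ps) R) phi ->
  bplus (trans (Let (Ms ++ Let Ns Q :: Ps) R))
    (trans (Let (Ms ++ Ns ++ Ps) (subst (flatten (length Ms) (length Ns) Q) R))).
Proof.
  intros HM. inversion HM as [| | | | | | |? ? ? phis psi HMs HR]; subst.
  apply Forall2_app_inv_l in HMs as (phis1 & phis2 & H1 & H2 & ->).
  inversion H2 as [|? chi ? psis HL HP]; subst.
  inversion HL as [| | | | | | |? ? ? chis ? HN HQ]; subst.
  pose proof (Forall2_length H1) as Hm. pose proof (Forall2_length HN) as Hk.
  simpl. apply bplus_congr; [now constructor|].
  rewrite !map_app, !chain_app, map_cons.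
  cbn [map chain].
  apply bplus_congr; [apply bstep_chain_body|].
  rewrite rename_rename, rename_subst_Var.
  erewrite subst_trans_Let by eauto.
  (* [tau] is the net effect of the last two beta steps on the continuation's body: [y] becomes [Q],
     and outer variables move past the binders of [Ns]. *)
  set (tau x := match x with 0 => trans Q | S y => Var (length Ns + y) end).
  eapply t_trans;
    [apply t_step, B_AppL, B_Lam, bstep_chain_body, B_AppR, (B_Beta (Var 0))|].
  eapply t_trans; [apply t_step, B_Beta|].
  rewrite subst_chain, !length_map. cbn [subst].
  rewrite iter_up, Nat.ltb_irrefl, Nat.sub_diag.
  change (inst [trans Q] 0) with (trans Q).
  erewrite subst_iter_up_closed
    by (try (apply typing_trans; eassumption); now rewrite length_map).
  (* The [Ns] were shifted past the continuation variable, so substituting for it only cancels the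
     shift. *)
  rewrite (map_map (rename S)), (map_ext _ (fun M => M)), map_id
    by (intros; apply subst_inst_rename_S).
  (* The third step is taken up to an equation, which is then checked on the [Ns], the [Ms] and the
     body in turn. *)
  refine (eq_ind _ (bplus _)
    (t_step _ _ _ _ (bstep_chain_body _ _ _ (B_Beta (rename (up_ren _) _) _))) _ _).
  f_equal.
  { rewrite !map_map. apply map_ext. intros M. rewrite rename_rename.
    symmetry. apply rename_subst_Var. }
  rewrite subst_rename, (subst_ext _ _ tau)
    by (intros [|x]; [reflexivity|apply inst_singleton_S]).
  rewrite subst_chain, !length_map. f_equal.
  - rewrite !map_map. apply map_ext. intros M.
    rewrite !rename_rename, subst_rename, (rename_subst_Var (trans M)).
    apply subst_ext. intros x. simpl. f_equal.
    rewrite length_app, !length_map. lia.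
  (* The outer continuation variable moves from index [length Ms + 1 + length Ps] to
     [length Ms + length Ns + length Ps]. *)
  - simpl. rewrite iter_up, !length_app. simpl length.
    destruct (Nat.ltb_spec (length Ms + S (length Ps)) (length Ms)); [lia|].
    replace (length Ms + S (length Ps) - length Ms) with (S (length Ps)) by lia.
    simpl. do 2 f_equal.
    rewrite (trans_subst R (phis1 ++ chi :: psis) (phis1 ++ chis ++ psis) psi)
      by (auto; rewrite Hm, Hk; now apply typed_subst_flatten).
    (* Lifting [tau] under the binders of [Ms] reproduces the three cases of [flatten]. *)
    apply subst_ext. intros x. rewrite iter_up. unfold flatten.
    destruct (Nat.compare_spec x (length Ms)) as [->|Hlt|Hgt].
    + rewrite Nat.ltb_irrefl, Nat.sub_diag. symmetry. eapply trans_rename, HQ.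
    + now apply Nat.ltb_lt in Hlt as ->.
    + destruct (Nat.ltb_spec x (length Ms)); [lia|].
      destruct (x - length Ms) as [|y] eqn:E; [lia|]. simpl. f_equal. lia.
Qed.

Lemma simulate_contract Gamma M M' phi :
  contract M M' -> typing Gamma M phi -> bplus (trans M) (trans M').
Proof.
  intros H HM. destruct H as [M N|M N|M N|Ms Ns Q Ps R|Ms N|M].
  - inversion HM as [| |? ? ? chi ? HL HN| | | | |]; subst.
    inversion HL; subst.
    rewrite (trans_subst M (chi :: Gamma) Gamma phi)
      by (auto; apply (typed_subst_inst Gamma [N] [chi]); auto).
    rewrite (subst_ext _ _ (inst [trans N])) by (intros [|[|x]]; reflexivity).
    apply t_step, B_Beta.
  - apply t_step, B_Pair1.
  - apply t_step, B_Pair2.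
  - eauto using simulate_LetLet.
  - eauto using simulate_LetPure.
  (* This is [C_LetPure] without arguments, where [inst []] is the identity. *)
  - pose proof (simulate_LetPure _ [] _ _ HM) as H. simpl in *.
    rewrite subst_Var in H; [exact H|]. intros [|x]; reflexivity.
Qed.

(** Each immediate subterm occurs exactly once in a translation, at a position where [bstep] may
    act, because translations contain neither [Pure] nor [Let]. *)
Lemma simulate_step M M' :
  step M M' -> forall Gamma phi, typing Gamma M phi -> bplus (trans M) (trans M').
Proof.
  induction 1 as [M M' H|M M' _ IH|M M' N _ IH|M N N' _ IH|M M' N _ IH|M N N' _ IH
    |M M' _ IH|M M' _ IH|M M' _ IH|Ms M M' Ps N _ IH|Ms N N' _ IH];
    intros Gamma phi HM; [eauto using simulate_contract|inversion HM; subst ..];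
    try (specialize (IH _ _ ltac:(eassumption)); simpl; revert IH).
  - apply bplus_congr. now constructor.
  - apply (bplus_congr (fun M => App M _)). now constructor.
  - apply bplus_congr. now constructor.
  - apply (bplus_congr (fun M => Pair M _)). now constructor.
  - apply bplus_congr. now constructor.
  - apply bplus_congr. now constructor.
  - apply bplus_congr. now constructor.
  - apply (bplus_congr (fun M => Lam (App (Var 0) (rename S M)))).
    intros. now apply B_Lam, B_AppR, bstep_rename.
  - match goal with H : Forall2 _ _ _ |- _ =>
      apply Forall2_app_inv_l in H as (phis1 & phis2 & _ & H & _); inversion H; subst end.
    specialize (IH _ _ ltac:(eassumption)). simpl. rewrite !map_app, !length_app.
    revert IH. simpl.
    apply (bplus_congr (fun M => Lam (chain (_ ++ rename S M :: _) _))).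
    intros. now apply B_Lam, bstep_chain_arg, bstep_rename.
  - apply (bplus_congr (fun N => Lam (chain _ (App _ (App _ N))))).
    intros. now apply B_Lam, bstep_chain_body, B_AppR, B_AppR.
Qed.

(** * Strong normalisation of the modal calculus *)

Lemma typing_Acc_step Gamma M phi :
  typing Gamma M phi -> Acc (fun M' M => step M M') M.
Proof.
  intros HM. pose proof (Acc_clos_trans _ _ _ (typing_SN _ _ _ (typing_trans _ _ _ HM))) as H.
  remember (trans M) as T eqn:E. revert M E HM.
  induction H as [T _ IH]; intros M -> HM. constructor. intros M' Hst.
  apply (IH (trans M')); eauto using subject_reduction.
  (* Accessibility concerns the closure of the converse relation, the simulation the converse of the
     closure; the two coincide. *)
  apply clos_trans_transp_permute. unfold transp.
  eapply simulate_step; eassumption.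
Qed.

Theorem theorem3 (Gamma : ctx) (M : tm) (phi : ty) :
  typing Gamma M phi ->
  ~ exists Ms : nat -> tm, Ms 0 = M /\ forall i : nat, step (Ms i) (Ms (S i)).
Proof.
  intros HM (Ms & <- & Hst).
  (* Quantifying over all [i] lets the induction on accessibility move from [Ms i] to [Ms (S i)]. *)
  assert (H : forall T, Acc (fun M' M => step M M') T -> forall i, Ms i <> T).
  { induction 1 as [T _ IH]. intros i <-.
    now apply (IH _ (Hst i) (S i)). }
  apply (H _ (typing_Acc_step _ _ _ HM) 0 eq_refl).
Qed.
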